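(* Let a right triangle in the Euclidean plane have hypotenuse of length $l_1$ and legs of lengths $l_2$ and $l_3$. For $i=1,2,3$, let $c_i$ denote the length of the non-degenerate conic arc constructed symmetrically on the side of length $l_i$, with fixed eccentricity $e\in[0,+\infty)$ (the same for all three sides) and constant ratio $k:=\frac{l_i}{f_i}$ (the same for $i=1,2,3$), where $f_i\in\mathbb{R}$ is the length of the sagitta of the arc on the side of length $l_i$. Then $$c_1^2=c_2^2+c_3^2 .$$
   Context: A non-degenerate conic is a circle (eccentricity $e=0$), an ellipse ($0<e<1$), a parabola ($e=1$) or a hyperbola ($e>1$). A conic arc is constructed symmetrically on a segment if the segment is the chord of the arc (the arc has the endpoints of the segment as its endpoints) and the arc is symmetric with respect to the perpendicular bisector of the segment, this bisector being an axis of symmetry of the conic. The sagitta of such an arc is the segment joining the midpoint of the chord to the point where the arc meets the perpendicular bisector of the chord. The arc with given eccentricity, chord and sagitta length is regarded as uniquely determined, which is why one speaks of ''the'' arc on each side.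
   Formalization: For 0<e<1 the arc with given eccentricity, chord and sagitta is not unique (the bisector may be the major or the minor axis) and mixed choices falsify the claim; the three perpendicular bisectors are therefore assumed to be all focal axes or all non-focal axes of their conics. *)

(* Defs.v *)
From HB Require Import structures.
From mathcomp Require Import all_boot all_order all_algebra.
From mathcomp Require Import all_classical all_reals all_analysis.

Set Implicit Arguments.
Unset Strict Implicit.
Unset Printing Implicit Defensive.

Import Order.TTheory GRing.Theory Num.Theory.
Import numFieldNormedType.Exports.

Local Open Scope classical_set_scope.
Local Open Scope ring_scope.

(* The Euclidean plane is R * R.  The library norm on a product is the max
   norm, which gives the right topology but not the right distances. *)

Section Plane.
Variable R : realType.
Implicit Types (u v n X P Q F D : R * R) (e f : R) (K : set (R * R)).

Definition dot u v : R := u.1 * v.1 + u.2 * v.2.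

Definition eucl_norm u : R := Num.sqrt (dot u u).

Definition eucl_dist P Q : R := eucl_norm (P - Q).

Definition midpoint P Q : R * R := 2^-1 *: (P + Q).

Definition bisector P Q : set (R * R) :=
  [set X | dot (X - midpoint P Q) (Q - P) = 0].

(* Reflection across [bisector P Q], for P <> Q. *)
Definition bisector_refl P Q X : R * R :=
  X - (2 * dot (X - midpoint P Q) (Q - P) / dot (Q - P) (Q - P)) *: (Q - P).

Definition bisector_symmetric P Q (S : set (R * R)) : Prop :=
  forall X, S X -> S (bisector_refl P Q X).

(* Non-degenerate conic of eccentricity e having F as a focus.  For e = 0 it is
   a circle and its focus is the centre; for e > 0 the focus-directrix property
   is used, the directrix being the line through D with unit normal n, which is
   at distance |<X - D, n>| from X.  For e > 1 both branches are included. *)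
Definition conic_with_focus e F K : Prop :=
  (e = 0 /\ exists2 r : R, 0 < r & K = [set X | eucl_dist X F = r]) \/
  (0 < e /\ exists D n, [/\ eucl_norm n = 1, dot (F - D) n != 0 &
     K = [set X | eucl_dist X F = e * `|dot (X - D) n|]]).

Definition nondegenerate_conic e K : Prop :=
  exists F, conic_with_focus e F K.

(* The bisector of PQ passes through a focus of K.  When it is an axis of
   symmetry of K, this says that it is the focal (major, transverse) axis. *)
Definition focal_bisector e K P Q : Prop :=
  exists2 F, conic_with_focus e F K & bisector P Q F.

(* The arc is the image of a simple curve g parametrized by [0, 1]. *)
Definition symmetric_conic_arc e K P Q (g : R -> R * R) : Prop :=
  [/\ nondegenerate_conic e K, bisector_symmetric P Q K,
      [/\ {within `[0, 1], continuous g}, {in `[0, 1] &, injective g},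
          g 0 = P & g 1 = Q],
      g @` `[0, 1] `<=` K &
      bisector_symmetric P Q (g @` `[0, 1])].

Definition sagitta_length P Q (g : R -> R * R) f : Prop :=
  exists S, [/\ (g @` `[0, 1]) S, bisector P Q S & f = eucl_dist (midpoint P Q) S].

(* Length of the polygon inscribed in g at the points of the partition a :: s;
   same conventions as [variation] and [total_variation], which are only
   available for real-valued functions. *)
Definition polygon_length (a b : R) (g : R -> R * R) (s : seq R) : R :=
  let G := g \o nth b (a :: s) in
  \sum_(0 <= i < size s) eucl_dist (G i.+1) (G i).

Definition curve_length (a b : R) (g : R -> R * R) : \bar R :=
  ereal_sup [set (polygon_length a b g s)%:E | s in itv_partition a b].

End Plane.

(* Main.v *)
(* In a frame with origin at the end S of the sagitta and axes along the chord
   and its bisector, a conic with the bisector as axis of symmetry has equation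
   x^2 = 2 p u - kappa u^2, where kappa depends only on e and on whether the
   bisector is the focal axis.  The slope m = u / x of the chord from S is a
   strictly monotone parameter on the arc and runs from -2/k to 2/k; the
   condition that the endpoint of the chord lies on the conic makes p / l a
   function of kappa and k.  Hence every arc is, up to isometry, l times the same
   model curve, its length is l L with L independent of the side, and the claim
   reduces to the theorem of Pythagoras. *)

Require Import Defs.
From HB Require Import structures.
From mathcomp Require Import all_boot all_order all_algebra.
From mathcomp Require Import all_classical all_reals all_analysis.
From mathcomp Require Import ring lra.
Import Order.TTheory GRing.Theory Num.Theory.
Import numFieldNormedType.Exports.
Set Implicit Arguments.
Unset Strict Implicit.
Local Open Scope classical_set_scope.
Local Open Scope ring_scope.

(** * Intermediate values, partitions, and curve length under a change of parameter *)

Lemma IVT_between (R : realType) (c d a b v : R) (f : R -> R) :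
  {within `[c, d], continuous f} -> a \in `[c, d] -> b \in `[c, d] ->
  f a <= v <= f b ->
  exists t, [/\ t \in `[c, d], Num.min a b <= t <= Num.max a b & f t = v].
Proof.
move=> fc; rewrite !in_itv/= => /andP[ca ad] /andP[cb bd] /andP[fav vfb].
have mM : Num.min a b <= Num.max a b by rewrite ge_min le_max lexx.
have sub : `[Num.min a b, Num.max a b] `<=` `[c, d]%classic.
  move=> t; rewrite /= !in_itv/= => /andP[].
  by rewrite ge_min le_max => /orP[] ? /orP[] ?; apply/andP; split; lra.
have [|t tab ftv] := IVT (v := v) mM (continuous_subspaceW sub fc).
  case: (leP a b) => _; rewrite ?(minC (f b)) ?(maxC (f b));
  by rewrite ge_min le_max fav vfb ?orbT.
by exists t; split=> //; exact: sub.
Qed.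

(** Ensures that no partition of the image interval is missed when two suprema of polygon lengths
    are compared. The first point is pulled back by the intermediate value theorem, the others by
    induction on the interval to its right. *)
Lemma partition_pullback (R : realType) (f : R -> R) (a b : R) (s : seq R) :
  a <= b -> {within `[a, b], continuous f} ->
  {in `[a, b] &, {mono f : x y / x <= y}} ->
  itv_partition (f a) (f b) s ->
  exists2 t, itv_partition a b t & s = map f t.
Proof.
move=> + + + [+ /eqP].
elim: s a => [|y s IHs] a ab fc fm /=.
  (* An empty partition forces [f a = f b], hence [a = b] because [f] reflects the order. *)
  move=> _ fab; exists [::] => //; split=> //=; apply/eqP.
  by apply/le_anti; rewrite ab -fm ?in_itv/= ?lexx ?ab// fab lexx.
move=> /andP[fay ys] lasts.
have yb : y <= f b.
  by have /itv_partition_le : itv_partition y (f b) s by split=> //; apply/eqP.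
have [c [cI _ fcy]] := @IVT_between _ a b a b y f fc
  ltac:(by rewrite in_itv/= lexx ab) ltac:(by rewrite in_itv/= lexx ab)
  ltac:(by rewrite (ltW fay) yb).
subst y; have /andP[ac cb] : a <= c <= b by move: cI; rewrite in_itv.
have sub : `[c, b] `<=` `[a, b]%classic.
  by move=> t; rewrite /= !in_itv/= => /andP[ct ->]; rewrite (le_trans ac).
have [|||t [tp tl] ->] := IHs c cb (continuous_subspaceW sub fc) => //.
  by move=> x z xI zI; apply: fm; exact: sub.
exists (c :: t) => //; split => //=; rewrite tp andbT.
by rewrite lt_neqAle ac andbT; apply: contraTneq fay => ->; rewrite ltxx.
Qed.

(* Inscribed polygons of [g] and of [G] correspond to each other through the
   change of parameter [m]. *)
Lemma curve_length_reparam (R : realType) (a b l : R) (m : R -> R)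
    (g G : R -> R * R) :
  a <= b -> 0 < l -> {within `[a, b], continuous m} ->
  {in `[a, b] &, {mono m : x y / x <= y}} ->
  {in `[a, b] &, forall x y,
     eucl_dist (g x) (g y) = l * eucl_dist (G (m x)) (G (m y))} ->
  curve_length a b g = (l%:E * curve_length (m a) (m b) G)%E.
Proof.
move=> ab l0 mc mm gG.
have nthI t i : itv_partition a b t -> (i < (size t).+1)%N ->
    nth b (a :: t) i \in `[a, b].
  by move=> abt it; rewrite in_itv/= itv_partition_nth_ge ?itv_partition_nth_le.
have pol t : itv_partition a b t ->
    polygon_length a b g t = l * polygon_length (m a) (m b) G (map m t).
  move=> abt; rewrite /polygon_length size_map mulr_sumr.
  apply: eq_big_nat => i /andP[_ ilt].
  rewrite /comp -map_cons !(nth_map b); [|exact: ltnW|by []].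
  by apply: gG; apply: nthI => //; exact: ltnW.
rewrite /curve_length. rewrite -(ereal_sup_pZl _ l0); congr ereal_sup.
apply/seteqP; split=> [_ [t abt <-]|_ [_ [s mabs <-] <-]].
  exists (polygon_length (m a) (m b) G (map m t))%:E;
    last by rewrite -EFinM -pol.
  exists (map m t) => //; case: (abt) => at_ /eqP lt_; split.
    apply: (homo_path_in (P := mem `[a, b]) (e := <%R)) at_.
      by move=> x y xI yI; rewrite !ltNge mm.
    by apply/allP => x /(nthP b)[i ilt <-]; exact: nthI.
  by rewrite last_map lt_.
have [t abt ->] := partition_pullback ab mc mm mabs.
by exists t => //; rewrite -EFinM -pol.
Qed.

(** * Parametrization of an arc by the slope from its vertex *)

(* The equation [x^2 = 2 p u - kappa u^2] describes every non-degenerate conic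
   with a vertex at the origin and the u-axis as axis.  The parameter [m] is
   the slope [u / x] of the chord from the vertex, written as
   [x / (2 p - kappa u)] to be defined at the vertex too. *)
Lemma vertex_arc_param (R : realType) (x u : R -> R) (h f kappa p s0 : R) :
  0 < h -> 0 < f -> p != 0 ->
  {within `[0, 1], continuous x} -> {within `[0, 1], continuous u} ->
  {in `[0, 1] &, forall s t, x s = x t -> u s = u t -> s = t} ->
  x 0 = - h -> u 0 = f -> x 1 = h -> u 1 = f ->
  s0 \in `[0, 1] -> x s0 = 0 -> u s0 = 0 ->
  {in `[0, 1], forall s, x s ^+ 2 = 2 * p * u s - kappa * u s ^+ 2} ->
  exists m : R -> R,
    [/\ {within `[0, 1], continuous m}, {in `[0, 1] &, {mono m : s t / s <= t}},
        m 0 = - (f / h), m 1 = f / h &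
        {in `[0, 1], forall s, x s = 2 * p * m s / (1 + kappa * m s ^+ 2) /\
                               u s = 2 * p * m s ^+ 2 / (1 + kappa * m s ^+ 2)}].
Proof.
move=> h0 f0 pn0 xc uc inj x0 u0 x1 u1 s0I xs0 us0 eqn.
have I0 : (0 : R) \in `[0, 1] by rewrite in_itv/= lexx ler01.
have I1 : (1 : R) \in `[0, 1] by rewrite in_itv/= lexx ler01.
have eqn1 : h ^+ 2 = 2 * p * f - kappa * f ^+ 2 by rewrite -u1 -x1 eqn.
have h20 : 0 < h ^+ 2 by rewrite exprn_gt0.
(* For [kappa < 0] and [p < 0] no point of the conic has [0 < u < 2 p / kappa], the gap between the
   two branches; an arc from the vertex to height [f] would enter it at height [v]. *)
have p0 : 0 < p.
  have [k0|k0] := leP 0 kappa.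
    by have := mulr_ge0 k0 (sqr_ge0 f); nra.
  rewrite ltNge; apply/negP => ple.
  have pk : 0 < p / kappa by rewrite ltr_ndivlMr// mul0r lt_neqAle pn0.
  pose v := Num.min f (p / kappa).
  have v0 : 0 < v by rewrite lt_min f0.
  have [|s [sI _ usv]] := @IVT_between _ 0 1 s0 1 v u uc s0I I1.
    by rewrite us0 u1 (ltW v0) ge_min lexx.
  have : kappa * v >= p.
    have /(ler_wnM2l (ltW k0)) : v <= p / kappa by rewrite ge_min lexx orbT.
    by rewrite mulrCA divff ?mulr1 ?lt_eqF.
  by have := sqr_ge0 (x s); rewrite eqn// usv; nra.
(* For [p > 0] and [kappa < 0] the gap is [2 p / kappa < u < 0], and again the arc cannot cross
   it. *)
have upos s : s \in `[0, 1] -> 0 <= u s.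
  move=> sI; have [k0|k0] := leP 0 kappa.
    by have := sqr_ge0 (x s); rewrite eqn//; nra.
  rewrite leNgt; apply/negP => us.
  have pk : p / kappa < 0 by rewrite ltr_ndivrMr// mul0r.
  pose v := Num.max (u s) (p / kappa).
  have v0 : v < 0 by rewrite gt_max us.
  have [|t [tI _ utv]] := @IVT_between _ 0 1 s s0 v u uc sI s0I.
    by rewrite us0 (ltW v0) le_max lexx.
  have : kappa * v <= p.
    have /(ler_wnM2l (ltW k0)) : p / kappa <= v by rewrite le_max lexx orbT.
    by rewrite mulrCA divff ?mulr1 ?lt_eqF.
  by have := sqr_ge0 (x t); rewrite eqn// utv; nra.
have den s : s \in `[0, 1] -> 0 < 2 * p - kappa * u s.
  move=> sI; have := upos s sI; have [k0|k0] := leP kappa 0; first by nra.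
  rewrite le_eqVlt => /orP[/eqP <-|us]; first by nra.
  rewrite lt_neqAle; apply/andP; split; last first.
    by have := sqr_ge0 (x s); rewrite eqn//; nra.
  (* This point would be the opposite vertex of an ellipse: between it and the first
     vertex the arc would run through an endpoint a second time. *)
  apply/eqP => us2.
  have hfu : h ^+ 2 = f * kappa * (u s - f).
    have -> : h ^+ 2 = (2 * p - kappa * u s + kappa * u s) * f - kappa * f ^+ 2.
      by rewrite eqn1; ring.
    by rewrite -us2; ring.
  have fu : f < u s by rewrite -subr_gt0 -(pmulr_rgt0 _ (mulr_gt0 f0 k0)) -hfu.
  have [|c [cI cs ucf]] := @IVT_between _ 0 1 s0 s f u uc s0I sI.
    by rewrite us0 (ltW f0) ltW.
  (* The conic meets the line [u = f] only at the ends of the chord, so injectivity leaves [0] and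
     [1] for [c]; but [c] lies between [s0] and [s], both interior. *)
  have : c = 0 \/ c = 1.
    have : (x c - h) * (x c + h) = 0.
      by rewrite -subr_sqr eqn// ucf; nra.
    move/eqP; rewrite mulf_eq0 subr_eq0 addr_eq0 => /orP[]/eqP xc'.
      by right; apply: inj; rewrite // ?x1 ?u1.
    by left; apply: inj; rewrite // ?x0 ?u0.
  move: s0I sI cs; rewrite !in_itv/= => /andP[s0ge s0le] /andP[sge sle].
  have s0gt : 0 < s0.
    rewrite lt_def s0ge andbT.
    by apply: contraTneq f0 => s0E; rewrite -us0 s0E u0 ltxx.
  have s0lt : s0 < 1.
    rewrite lt_neqAle s0le andbT.
    by apply: contraTneq f0 => s0E; rewrite -us0 s0E u1 ltxx.
  have sgt : 0 < s.
    by rewrite lt_def sge andbT; apply: contraTneq fu => ->; rewrite u0 ltxx.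
  have slt : s < 1.
    by rewrite lt_neqAle sle andbT; apply: contraTneq fu => ->; rewrite u1 ltxx.
  rewrite ge_min le_max => /andP[cge cle] [] cE; move: cge cle; rewrite cE.
    by rewrite !leNgt s0gt sgt.
  by rewrite !(leNgt 1) s0lt slt.
pose m s := x s / (2 * p - kappa * u s).
have mE s : s \in `[0, 1] ->
    [/\ 1 + kappa * m s ^+ 2 = 2 * p / (2 * p - kappa * u s),
        x s = 2 * p * m s / (1 + kappa * m s ^+ 2) &
        u s = 2 * p * m s ^+ 2 / (1 + kappa * m s ^+ 2)].
  move=> sI; have d0 : 2 * p - kappa * u s != 0 by rewrite gt_eqF ?den.
  have p20 : 2 * p != 0 by rewrite mulf_neq0// pnatr_eq0.
  have m2 : m s ^+ 2 = u s / (2 * p - kappa * u s).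
    by rewrite expr_div_n eqn//; field.
  have -> : 1 + kappa * m s ^+ 2 = 2 * p / (2 * p - kappa * u s).
    by rewrite m2; field.
  split=> //; first by rewrite /m; field; rewrite d0 pn0.
  by rewrite m2; field; rewrite d0 pn0.
have mc : {within `[0, 1], continuous m}.
  apply/subspace_continuousP => s sI; apply: cvgM.
    by move/subspace_continuousP: xc; apply.
  apply: cvgV; first by rewrite gt_eqF ?den.
  apply: cvgB; first exact: cvg_cst.
  apply: cvgM; first exact: cvg_cst.
  by move/subspace_continuousP: uc; apply.
have d1 : 2 * p - kappa * f != 0 by rewrite -u1 gt_eqF ?den.
have hf : h / (2 * p - kappa * f) = f / h.
  apply/eqP; rewrite eqr_div ?(gt_eqF h0)// -expr2 eqn1; apply/eqP; ring.
have m0 : m 0 = - (f / h) by rewrite /m x0 u0 mulNr hf.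
have m1 : m 1 = f / h by rewrite /m x1 u1 hf.
exists m; split => //; last by move=> s /mE[].
(* A continuous injective function with [m 0 <= m 1] is increasing; [m] is injective because [mE]
   recovers the point from its slope. *)
apply: segment_continuous_inj_le => //.
  by rewrite m0 m1; have := divr_gt0 f0 h0; lra.
move=> s t sI tI mst; apply: inj => //.
  by have [_ -> _] := mE s sI; have [_ -> _] := mE t tI; rewrite mst.
by have [_ _ ->] := mE s sI; have [_ _ ->] := mE t tI; rewrite mst.
Qed.

(** * Vertex equations of circles and of focus-directrix conics, in coordinates *)

(** Subtracting the equations at the chord ends gives [a = 0], and the equation at the origin
    removes the constant term. The result is the vertex form with [p = b] and [kappa = 1]. *)
Lemma symmetric_circle_vertex_form (R : realType) (a b r h f : R) :
  0 < r -> 0 < h ->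
  (- h - a) ^+ 2 + (f - b) ^+ 2 = r ^+ 2 ->
  (h - a) ^+ 2 + (f - b) ^+ 2 = r ^+ 2 ->
  a ^+ 2 + b ^+ 2 = r ^+ 2 ->
  [/\ a = 0, f != 0, b != 0 &
      forall x u, (x - a) ^+ 2 + (u - b) ^+ 2 = r ^+ 2 ->
        x ^+ 2 = 2 * b * u - u ^+ 2].
Proof.
move=> r0 h0 qP qQ qS.
have a0 : a = 0.
  by apply/eqP; rewrite -(mulIr_eq0 _ (mulIf (lt0r_neq0 h0))); apply/eqP; lra.
have h20 : 0 < h ^+ 2 by rewrite exprn_gt0.
have r20 : 0 < r ^+ 2 by rewrite exprn_gt0.
subst a; split => //.
- by apply: contraTneq h20 => f0; rewrite -leNgt; move: qQ; rewrite f0; lra.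
- by apply: contraTneq r20 => b0; rewrite -qS b0 expr0n/= addr0 ltxx.
- by move=> x u; lra.
Qed.

Section FocusDirectrix.
Variables (R : realType) (e a b n1 n2 d h f : R).

(** Squared, so that the root in the distance and the absolute value disappear and the arguments
    become polynomial. *)
Definition focus_directrix_eq (x u : R) :=
  (x - a) ^+ 2 + (u - b) ^+ 2 = e ^+ 2 * (n1 * x + n2 * u - d) ^+ 2.

Hypotheses (e0 : 0 < e) (h0 : 0 < h) (n_unit : n1 ^+ 2 + n2 ^+ 2 = 1).
Hypothesis nondeg : n1 * a + n2 * b != d.
Hypotheses (qP : focus_directrix_eq (- h) f) (qQ : focus_directrix_eq h f).

Lemma focus_abscissa : a = - e ^+ 2 * n1 * (n2 * f - d).
Proof.
move: qP qQ; rewrite /focus_directrix_eq => qP' qQ'; apply/eqP; rewrite -subr_eq0.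
by rewrite -(mulIr_eq0 _ (mulIf (lt0r_neq0 h0))); apply/eqP; lra.
Qed.

(** On the line [u = f] the equation is quadratic in [x]. A third root makes it vanish identically,
    which forces [e^2 n1^2 = 1] and [b = f] and so puts the focus on the directrix, against
    [nondeg]. *)
Lemma chord_two_points z : focus_directrix_eq z f -> z = h \/ z = - h.
Proof.
move=> qz; have [/eqP|zh] := eqVneq (z ^+ 2 - h ^+ 2) 0.
  rewrite subr_sqr mulf_eq0 subr_eq0 addr_eq0 => /orP[]/eqP; first by left.
  by right.
case/negP: nondeg.
move: qP qQ qz; rewrite /focus_directrix_eq focus_abscissa => qP' qQ' qz'.
have en1 : e ^+ 2 * n1 ^+ 2 = 1.
  apply/eqP; rewrite eq_sym -subr_eq0 -(mulIr_eq0 _ (mulIf zh)); apply/eqP.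
  by lra.
have bf : f = b.
  apply/eqP; rewrite -subr_eq0 -sqrf_eq0; apply/eqP.
  have : (f - b) ^+ 2 = (1 - e ^+ 2 * n1 ^+ 2) *
     (e ^+ 2 * (n2 * f - d) ^+ 2 - h ^+ 2) by lra.
  by rewrite en1 subrr mul0r.
rewrite -bf; apply/eqP.
have -> : n1 * (- e ^+ 2 * n1 * (n2 * f - d)) = - (e ^+ 2 * n1 ^+ 2) * (n2 * f - d).
  by ring.
by rewrite en1; ring.
Qed.

Hypothesis qS : focus_directrix_eq 0 0.

Lemma sagitta_neq0 : f != 0.
Proof.
apply/eqP => f0; have := @chord_two_points 0; rewrite f0 => /(_ qS).
by have := h0; case; lra.
Qed.

Hypothesis oblique : exists z u, [/\ z != 0, z != h, z != - h,
  focus_directrix_eq z u & focus_directrix_eq (- z) u].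

(* Subtracting the equations at (z, u) and (- z, u) and using [focus_abscissa]
   gives [n1 n2 (u - f) = 0]; [u = f] would put three points of the conic on the
   chord, so the directrix is parallel to the chord or to its bisector. *)
Lemma symmetric_conic_vertex_form :
  exists2 p, p != 0 & forall x u, focus_directrix_eq x u ->
    x ^+ 2 = 2 * p * u - (if a == 0 then 1 - e ^+ 2 else (1 - e ^+ 2)^-1) * u ^+ 2.
Proof.
have aE := focus_abscissa; have e20 : e ^+ 2 != 0 by rewrite sqrf_eq0 gt_eqF.
have n12 : n1 * n2 = 0.
  case: oblique => z [u [z0 zh zNh qz qNz]].
  apply/eqP/negPn/negP => n12.
  have uf : u = f.
    apply/eqP; rewrite -subr_eq0.
    rewrite -(mulIr_eq0 _ (mulIf (mulf_neq0 (mulf_neq0 z0 n12) e20))); apply/eqP.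
    have : z * (a + e ^+ 2 * n1 * (n2 * u - d)) = 0.
      by move: qz qNz; rewrite /focus_directrix_eq; lra.
    by rewrite aE => <-; ring.
  rewrite uf in qz; case: (chord_two_points qz) => /eqP.
    by rewrite (negPf zh).
  by rewrite (negPf zNh).
move/eqP: n12; rewrite mulf_eq0 => /orP[]/eqP nE.
  (* Here the directrix is parallel to the chord and the focus lies on the bisector. A zero [p]
     would put the focus on the directrix. *)
  have n2E : n2 ^+ 2 = 1 by rewrite -n_unit nE expr0n add0r.
  have a0 : a = 0 by rewrite aE nE mulr0 mul0r.
  have bd : b ^+ 2 = e ^+ 2 * d ^+ 2.
    by move: qS; rewrite /focus_directrix_eq a0; lra.
  rewrite a0 eqxx; exists (b - e ^+ 2 * n2 * d).
    apply: contra nondeg; rewrite subr_eq0 nE mul0r add0r => /eqP p0.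
    rewrite -subr_eq0 -sqrf_eq0 -(mulrI_eq0 _ (mulfI e20)); apply/eqP.
    have n2b : n2 * b = e ^+ 2 * d by rewrite p0 -[RHS]mulr1 -n2E; ring.
    have b2 : b ^+ 2 = e ^+ 2 * e ^+ 2 * d ^+ 2.
      by rewrite p0 -[RHS]mulr1 -n2E; ring.
    have -> : e ^+ 2 * (n2 * b - d) ^+ 2 =
      (e ^+ 2 - 1) * (e ^+ 2 * e ^+ 2 * d ^+ 2 - e ^+ 2 * d ^+ 2).
      by rewrite n2b; ring.
    by rewrite -b2 -bd subrr mulr0.
  move=> x u; rewrite /focus_directrix_eq a0 nE => qx.
  have : e ^+ 2 * (0 * x + n2 * u - d) ^+ 2 =
      e ^+ 2 * n2 ^+ 2 * u ^+ 2 - 2 * e ^+ 2 * n2 * u * d + e ^+ 2 * d ^+ 2 by ring.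
  by rewrite n2E; lra.
(* Here the directrix is parallel to the bisector. With [e = 1] or [d = 0] the focus would lie on
   it; hence [a] is nonzero and the second value of [kappa] applies. *)
have n1E : n1 ^+ 2 = 1 by rewrite -n_unit nE expr0n addr0.
have {}aE : a = e ^+ 2 * n1 * d by rewrite aE nE; ring.
have a2 : a ^+ 2 = e ^+ 2 * e ^+ 2 * d ^+ 2.
  by rewrite aE -[RHS]mulr1 -n1E; ring.
have : (1 - e ^+ 2) * d != 0.
  apply: contra nondeg => /eqP ed.
  have -> : n1 * a + n2 * b = n1 ^+ 2 * e ^+ 2 * d by rewrite aE nE; ring.
  by rewrite n1E; apply/eqP; lra.
rewrite mulf_eq0 negb_or => /andP[ne1 d0].
have bd : b ^+ 2 = e ^+ 2 * (1 - e ^+ 2) * d ^+ 2.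
  by move: qS; rewrite /focus_directrix_eq; lra.
have ene0 : e != 0 by rewrite gt_eqF.
have b0 : b != 0 by rewrite -sqrf_eq0 bd !mulf_neq0 //.
have anz : a != 0.
  by rewrite -sqrf_eq0 a2 !mulf_neq0 //.
rewrite (negPf anz).
exists (b / (1 - e ^+ 2)); first by rewrite mulf_neq0 ?invr_eq0.
move=> x u; rewrite /focus_directrix_eq nE => qx.
have {}qx : (1 - e ^+ 2) * x ^+ 2 = 2 * b * u - u ^+ 2.
  have : e ^+ 2 * (n1 * x + 0 * u - d) ^+ 2 =
    e ^+ 2 * n1 ^+ 2 * x ^+ 2 - 2 * (e ^+ 2 * n1 * d) * x + e ^+ 2 * d ^+ 2 by ring.
  by rewrite -aE n1E; lra.
have -> : x ^+ 2 = (1 - e ^+ 2) * x ^+ 2 / (1 - e ^+ 2) by field.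
by rewrite qx; field.
Qed.
End FocusDirectrix.

(** * Orthonormal frames adapted to a chord and its sagitta *)

Section Frames.
Variable R : realType.
Implicit Types (P Q S F U V X Y w v : R * R).

Lemma dotC U V : dot U V = dot V U.
Proof. by rewrite /dot mulrC (mulrC U.2). Qed.

Lemma dotDl U V X : dot (U + V) X = dot U X + dot V X.
Proof. by rewrite /dot /=; ring. Qed.

Lemma dotBl U V X : dot (U - V) X = dot U X - dot V X.
Proof. by rewrite /dot /=; ring. Qed.

Lemma dotZl (c : R) U V : dot (c *: U) V = c * dot U V.
Proof. by rewrite /dot /= /GRing.scale/=; ring. Qed.

Lemma dot_ge0 U : 0 <= dot U U.
Proof. by rewrite /dot -!expr2 addr_ge0 ?sqr_ge0. Qed.

Lemma dot_eq0 U : (dot U U == 0) = (U == 0).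
Proof.
case: U => U1 U2; rewrite /dot/= -!expr2 paddr_eq0 ?sqr_ge0// !sqrf_eq0.
by rewrite -pair_eqE.
Qed.

Lemma sqr_eucl_norm U : eucl_norm U ^+ 2 = dot U U.
Proof. by rewrite /eucl_norm sqr_sqrtr ?dot_ge0. Qed.

Lemma eucl_dist_eq X Y (r : R) : 0 <= r ->
  eucl_dist X Y = r -> dot (X - Y) (X - Y) = r ^+ 2.
Proof. by move=> r0 <-; rewrite -sqr_eucl_norm. Qed.

Lemma eucl_dist_gt0 P Q : P <> Q -> 0 < eucl_dist P Q.
Proof.
move=> PQ; rewrite sqrtr_gt0 lt_def dot_ge0 dot_eq0 subr_eq0 andbT.
exact/eqP.
Qed.

(** The last clause is Parseval's identity, through which distances are computed in coordinates. *)
Definition orthonormal w v :=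
  [/\ dot w w = 1, dot v v = 1, dot w v = 0 &
      forall U V, dot U V = dot U w * dot V w + dot U v * dot V v].

Lemma orthonormal_rot (sigma : R) w : sigma ^+ 2 = 1 -> dot w w = 1 ->
  orthonormal w (sigma *: (- w.2, w.1)).
Proof.
move=> s2 w1; split=> [//|||U V]; rewrite /dot/= /GRing.scale/=.
- by rewrite -[RHS]w1 -[RHS]mul1r -s2 /dot; ring.
- by ring.
transitivity (dot w w * (U.1 * V.1 + U.2 * V.2)); first by rewrite w1 mul1r.
transitivity ((w.1 * U.1 + w.2 * U.2) * (w.1 * V.1 + w.2 * V.2) +
   sigma ^+ 2 * ((U.2 * w.1 - U.1 * w.2) * (V.2 * w.1 - V.1 * w.2))).
  by rewrite s2 /dot; ring.
by ring.
Qed.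

Lemma exists_frame P Q S : P <> Q -> bisector P Q S ->
  exists w v, [/\ orthonormal w v, Q - P = eucl_dist P Q *: w &
    midpoint P Q - S = eucl_dist (midpoint P Q) S *: v].
Proof.
move=> PQ SPQ; have l0 := eucl_dist_gt0 PQ.
set l := eucl_dist P Q in l0 *; set M := midpoint P Q.
pose w := l^-1 *: (Q - P).
have ww : dot w w = 1.
  rewrite dotZl dotC dotZl.
  have -> : dot (Q - P) (Q - P) = l ^+ 2.
    by rewrite -(eucl_dist_eq (ltW l0) erefl) /dot /=; ring.
  by rewrite expr2 mulKf ?mulVf ?gt_eqF.
pose c := dot (M - S) (- w.2, w.1).
have MSw : dot (M - S) w = 0.
  have -> : dot (M - S) w = - l^-1 * dot (S - M) (Q - P).
    by rewrite [dot _ w]dotC dotZl /dot /=; ring.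
  by rewrite SPQ mulr0.
have MS : M - S = c *: (- w.2, w.1).
  have -> : M - S = (dot w w * (M - S).1, dot w w * (M - S).2).
    by rewrite ww !mul1r -surjective_pairing.
  have e1 : dot w w * (M - S).1 = c * - w.2 + dot (M - S) w * w.1.
    by rewrite /c /dot /=; ring.
  have e2 : dot w w * (M - S).2 = c * w.1 + dot (M - S) w * w.2.
    by rewrite /c /dot /=; ring.
  by rewrite e1 e2 MSw !mul0r !addr0.
have f_c : eucl_dist M S = `|c|.
  rewrite /eucl_dist /eucl_norm MS -sqrtr_sqr; congr Num.sqrt.
  by rewrite -[RHS]mulr1 -ww /dot/= /GRing.scale/=; ring.
(* The sign turns [v] from [S] towards the chord, so that the chord has height [|c|], the length of
   the sagitta. *)
pose sigma : R := if 0 <= c then 1 else -1.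
exists w, (sigma *: (- w.2, w.1)); split.
- apply: orthonormal_rot => //; rewrite /sigma.
  by case: ifP; rewrite ?sqrrN expr1n.
- by rewrite /w scalerA divff ?gt_eqF// scale1r.
rewrite f_c scalerA MS; congr (_ *: _); rewrite /sigma.
by case: leP => [/ger0_norm->|/ltr0_norm->]; rewrite ?mulr1// mulrN1 opprK.
Qed.

Lemma dot_bisector_refl P Q S X w v : P <> Q -> orthonormal w v ->
  Q - P = eucl_dist P Q *: w -> dot (midpoint P Q - S) w = 0 ->
  dot (bisector_refl P Q X - S) w = - dot (X - S) w /\
  dot (bisector_refl P Q X - S) v = dot (X - S) v.
Proof.
move=> PQ [ww vv wv _] QP MSw; have l0 := eucl_dist_gt0 PQ.
rewrite /bisector_refl QP; move: (midpoint P Q) MSw => M MSw.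
rewrite !(dotZl, dotBl) ![dot _ (_ *: w)]dotC !(dotZl, dotBl).
move: MSw; rewrite ww wv dotBl; set l := eucl_dist P Q in l0 *.
rewrite !(dotC w) => MS; split; last by rewrite !mulr0 subr0.
have -> : dot M w = dot S w by lra.
by field; rewrite gt_eqF.
Qed.

Lemma bisector_frame P Q S F w : P <> Q ->
  Q - P = eucl_dist P Q *: w -> dot (midpoint P Q - S) w = 0 ->
  bisector P Q F <-> dot (F - S) w = 0.
Proof.
move=> PQ QP MSw; have l0 := eucl_dist_gt0 PQ.
rewrite /bisector/= QP dotC dotZl dotC.
have -> : dot (F - midpoint P Q) w = dot (F - S) w.
  by move: MSw; rewrite !dotBl; lra.
split=> [/eqP|->]; last by rewrite mulr0.
by rewrite mulf_eq0 gt_eqF//= => /eqP.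
Qed.

(** Carries the coordinate results over to the plane with origin [S]. The mirror pair [X], [Y]
    expresses the symmetry of [K] beyond the chord ends, which alone would not exclude an oblique
    directrix. *)
Lemma conic_vertex_form (e h f : R) F (K : set (R * R)) P Q S w v :
  0 < h -> orthonormal w v -> conic_with_focus e F K ->
  K P -> dot (P - S) w = - h -> dot (P - S) v = f ->
  K Q -> dot (Q - S) w = h -> dot (Q - S) v = f -> K S ->
  (exists X Y, [/\ K X, K Y, dot (Y - S) w = - dot (X - S) w &
     dot (Y - S) v = dot (X - S) v] /\
     [/\ dot (X - S) w != 0, dot (X - S) w != h & dot (X - S) w != - h]) ->
  f != 0 /\ exists2 p, p != 0 & forall X, K X ->
    dot (X - S) w ^+ 2 = 2 * p * dot (X - S) v -
     (if dot (F - S) w == 0 then 1 - e ^+ 2 else (1 - e ^+ 2)^-1) *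
       dot (X - S) v ^+ 2.
Proof.
move=> h0 [ww vv wv pars] cF KP Pw Pv KQ Qw Qv KS obl.
have SS U : dot (S - S) U = 0 by rewrite dotBl subrr.
set a := dot (F - S) w; set b := dot (F - S) v.
have distF X : dot (X - F) (X - F) =
    (dot (X - S) w - a) ^+ 2 + (dot (X - S) v - b) ^+ 2.
  by rewrite pars !expr2 /a /b !dotBl; ring.
case: cF => [[e0 [r r0 KE]]|[e0 [D [n [n1 FD KE]]]]].
  have {}KE X : K X -> (dot (X - S) w - a) ^+ 2 + (dot (X - S) v - b) ^+ 2 = r ^+ 2.
    by rewrite KE => /(eucl_dist_eq (ltW r0)); rewrite distF.
  have [] := @symmetric_circle_vertex_form R a b r h f r0 h0.
  - by rewrite -Pw -Pv KE.
  - by rewrite -Qw -Qv KE.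
  - by have := KE _ KS; rewrite !SS; lra.
  move=> a0 f0 b0 circ; split=> //; exists b => // X /KE/circ ->.
  by rewrite a0 eqxx e0 expr0n subr0 mul1r.
set d := dot (D - S) n.
have DX X : dot (X - D) n = dot n w * dot (X - S) w + dot n v * dot (X - S) v - d.
  have -> : dot (X - D) n = dot (X - S) n - d by rewrite /d !dotBl; ring.
  by rewrite pars; ring.
have {}KE X : K X ->
    focus_directrix_eq e a b (dot n w) (dot n v) d (dot (X - S) w) (dot (X - S) v).
  rewrite KE /focus_directrix_eq => /eucl_dist_eq; rewrite distF => -> //.
    by rewrite exprMn real_normK ?num_real// DX.
  by rewrite mulr_ge0// ltW.
have qS : focus_directrix_eq e a b (dot n w) (dot n v) d 0 0.
  by have := KE _ KS; rewrite !SS.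
have nn : dot n w ^+ 2 + dot n v ^+ 2 = 1.
  by rewrite !expr2 -pars -sqr_eucl_norm n1 expr1n.
have nd : dot n w * a + dot n v * b != d.
  by apply: contra FD => /eqP ndE; rewrite DX subr_eq0 ndE.
have qP : focus_directrix_eq e a b (dot n w) (dot n v) d (- h) f.
  by rewrite -Pw -Pv; exact: KE.
have qQ : focus_directrix_eq e a b (dot n w) (dot n v) d h f.
  by rewrite -Qw -Qv; exact: KE.
split; first exact: (sagitta_neq0 h0 nd qP qQ qS).
have [|p p0 pE] := symmetric_conic_vertex_form e0 h0 nn nd qP qQ qS.
  case: obl => X [Y [[KX KY Yw Yv] [X0 Xh XNh]]].
  exists (dot (X - S) w), (dot (X - S) v); split=> //; first exact: KE.
  by rewrite -Yw -Yv; exact: KE.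
by exists p => // X /KE/pE.
Qed.

End Frames.

(** * Similarity of the arcs and their lengths *)

Lemma within_continuous_dot (R : realType) (A : set R) (g : R -> R * R)
    (S w : R * R) :
  {within A, continuous g} -> {within A, continuous (fun t => dot (g t - S) w)}.
Proof.
move=> /subspace_continuousP gc; apply/subspace_continuousP => t At.
have c1 : (fun t => (g t).1) @ within A (nbhs t) --> (g t).1.
  by apply: cvg_comp (gc t At) _; exact: cvg_fst.
have c2 : (fun t => (g t).2) @ within A (nbhs t) --> (g t).2.
  by apply: cvg_comp (gc t At) _; exact: cvg_snd.
rewrite /dot /=; apply: cvgD; apply: cvgM; try exact: cvg_cst.
  by apply: cvgB => //; exact: cvg_cst.
by apply: cvgB => //; exact: cvg_cst.
Qed.

(* The arc on a chord of length 1, as a function of the slope [m] of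
   [vertex_arc_param]; the chord-sagitta ratio [k] forces
   [2 p = k / 4 + kappa / k]. *)
Definition model_arc (R : realType) (kappa k m : R) : R * R :=
  ((k / 4 + kappa / k) * m / (1 + kappa * m ^+ 2),
   (k / 4 + kappa / k) * m ^+ 2 / (1 + kappa * m ^+ 2)).

(* The coefficient [kappa] of [vertex_arc_param]: besides the focal axis, only
   the minor axis of an ellipse can carry a symmetric arc. *)
Definition axis_ratio (R : realType) (e : R) (focal : Prop) : R :=
  if `[< focal >] then 1 - e ^+ 2 else (1 - e ^+ 2)^-1.

(** A conic may have two foci. Choosing one on the bisector whenever there is one lets the position
    of [F] alone decide the kind of axis. *)
Lemma exists_focus (R : realType) (e : R) (K : set (R * R)) (P Q : R * R) :
  nondegenerate_conic e K ->
  exists2 F, conic_with_focus e F K & focal_bisector e K P Q <-> bisector P Q F.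
Proof.
move=> [F cF]; have [foc|nfoc] := pselect (focal_bisector e K P Q).
  by case: (foc) => G cG GPQ; exists G.
by exists F => //; split=> // FPQ; case: nfoc; exists F.
Qed.

Lemma curve_length_symmetric_conic_arc (R : realType) (e k f : R)
    (K : set (R * R)) (P Q : R * R) (g : R -> R * R) :
  P <> Q -> symmetric_conic_arc e K P Q g -> sagitta_length P Q g f ->
  k = eucl_dist P Q / f ->
  curve_length 0 1 g = ((eucl_dist P Q)%:E *
    curve_length (- (2 / k)) (2 / k)
      (model_arc (axis_ratio e (focal_bisector e K P Q)) k))%E.
Proof.
move=> PQ [conK symK [gc ginj g0 g1] gK _] [S [[s0 s0I gs0] SPQ fE]] kE.
have [F cF focF] := exists_focus P Q conK.
have [w [v [ortho QP MS]]] := exists_frame PQ SPQ.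
have l0 := eucl_dist_gt0 PQ.
have [ww vv wv pars] := ortho.
set l := eucl_dist P Q in l0 kE QP *; rewrite -fE in MS.
have vw : dot v w = 0 by rewrite dotC.
have MSw : dot (midpoint P Q - S) w = 0 by rewrite MS dotZl vw mulr0.
pose h := l / 2; have h0 : 0 < h by rewrite divr_gt0.
have PE : P - S = f *: v - h *: w.
  rewrite -MS /h mulrC -scalerA -QP /midpoint; apply/eqP; rewrite -pair_eqE.
  by apply/andP; split; apply/eqP; rewrite /= /GRing.scale/=; field.
have QE : Q - S = f *: v + h *: w.
  rewrite -MS /h mulrC -scalerA -QP /midpoint; apply/eqP; rewrite -pair_eqE.
  by apply/andP; split; apply/eqP; rewrite /= /GRing.scale/=; field.
have Pw : dot (P - S) w = - h by rewrite PE dotBl !dotZl vw ww; ring.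
have Pv : dot (P - S) v = f by rewrite PE dotBl !dotZl vv wv; ring.
have Qw : dot (Q - S) w = h by rewrite QE dotDl !dotZl vw ww; ring.
have Qv : dot (Q - S) v = f by rewrite QE dotDl !dotZl vv wv; ring.
pose x t := dot (g t - S) w; pose u t := dot (g t - S) v.
have xc : {within `[0, 1], continuous x} by exact: within_continuous_dot.
have uc : {within `[0, 1], continuous u} by exact: within_continuous_dot.
have I0 : (0 : R) \in `[0, 1] by rewrite in_itv/= lexx ler01.
have I1 : (1 : R) \in `[0, 1] by rewrite in_itv/= lexx ler01.
have Kg t : t \in `[0, 1] -> K (g t) by move=> tI; apply: gK; exists t.
have KP : K P by rewrite -g0; exact: Kg.
have KQ : K Q by rewrite -g1; exact: Kg.
have KS : K S by rewrite -gs0; exact: Kg.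
have [|fn0 [p p0 eqn]] :=
    conic_vertex_form h0 ortho cF KP Pw Pv KQ Qw Qv KS.
  (* The abscissa [h / 2] differs from [0], [h] and [- h], so this point and its mirror image are
     the required pair. *)
  have [|t [tI _ xt]] := @IVT_between _ 0 1 0 1 (h / 2) x xc I0 I1.
    by rewrite /x g0 g1 Pw Qw; apply/andP; split; lra.
  have [Yw Yv] := dot_bisector_refl (g t) PQ ortho QP MSw.
  exists (g t), (bisector_refl P Q (g t)); rewrite -/(x t) xt; split.
    by split; [exact: Kg|apply: symK; exact: Kg|rewrite Yw -/(x t) xt|].
  by split; apply/eqP; lra.
have f0 : 0 < f by rewrite lt_def fn0 fE sqrtr_ge0.
have kappaE : (if dot (F - S) w == 0 then 1 - e ^+ 2 else (1 - e ^+ 2)^-1) =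
    axis_ratio e (focal_bisector e K P Q).
  rewrite /axis_ratio; congr (if _ then _ else _).
  have bF := bisector_frame F PQ QP MSw.
  by apply/eqP/asboolP => [/bF/focF|/focF/bF].
rewrite {}kappaE in eqn; set kappa := axis_ratio _ _ in eqn *.
have distE X Y : dot (X - Y) (X - Y) =
    (dot (X - S) w - dot (Y - S) w) ^+ 2 + (dot (X - S) v - dot (Y - S) v) ^+ 2.
  by rewrite pars !expr2 !dotBl; ring.
have [|||||||||m [mc mm m0 m1 mE]] := @vertex_arc_param R x u h f kappa p s0 h0 f0
    p0 xc uc.
- move=> s t sI tI xst ust; apply: ginj => //; apply/eqP.
  rewrite -subr_eq0 -dot_eq0 distE -/(x s) -/(u s) xst ust.
  by rewrite !subrr expr0n addr0.
- by rewrite /x g0.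
- by rewrite /u g0.
- by rewrite /x g1.
- by rewrite /u g1.
- by [].
- by rewrite /x gs0 subrr /dot !mul0r addr0.
- by rewrite /u gs0 subrr /dot !mul0r addr0.
- by move=> s sI; apply: eqn; exact: Kg.
have fh : f / h = 2 / k.
  by rewrite kE /h; field; rewrite !gt_eqF.
(* The conic equation at [Q], with [h = l / 2] and [f = l / k], determines [p]. *)
have pE : 2 * p = l * (k / 4 + kappa / k).
  have := eqn _ KQ; rewrite Qw Qv => hE.
  have -> : 2 * p = (h ^+ 2 + kappa * f ^+ 2) / f by rewrite hE; field.
  by rewrite kE /h; field; rewrite !gt_eqF.
have xE s : s \in `[0, 1] -> x s = l * (model_arc kappa k (m s)).1.
  by move=> sI; have [-> _] := mE s sI; rewrite pE /=; ring.
have uE s : s \in `[0, 1] -> u s = l * (model_arc kappa k (m s)).2.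
  by move=> sI; have [_ ->] := mE s sI; rewrite pE /=; ring.
rewrite -fh -m0 -m1; apply: curve_length_reparam => // s t sI tI.
rewrite /eucl_dist /eucl_norm distE -/(x s) -/(u s) -/(x t) -/(u t).
rewrite !xE// !uE// -[X in _ = X * _](gtr0_norm l0) -sqrtr_sqr -sqrtrM ?sqr_ge0//.
congr Num.sqrt; move: (model_arc _ _ _) (model_arc _ _ _) => U V.
by rewrite /dot /=; ring.
Qed.

Theorem theorem1p2p1 (R : realType) (A B C : R * R)
  (hBC : B <> C) (hCA : C <> A) (hright : dot (A - C) (B - C) = 0)
  (l1 l2 l3 : R)
  (hl1 : l1 = eucl_dist A B) (hl2 : l2 = eucl_dist B C) (hl3 : l3 = eucl_dist C A)
  (e k : R) (he : 0 <= e)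
  (K1 K2 K3 : set (R * R)) (g1 g2 g3 : R -> R * R)
  (harc1 : symmetric_conic_arc e K1 A B g1)
  (harc2 : symmetric_conic_arc e K2 B C g2)
  (harc3 : symmetric_conic_arc e K3 C A g3)
  (* the arcs are erected on the same kind of axis (matters only if 0 < e < 1) *)
  (haxis12 : focal_bisector e K1 A B <-> focal_bisector e K2 B C)
  (haxis13 : focal_bisector e K1 A B <-> focal_bisector e K3 C A)
  (f1 f2 f3 : R)
  (hf1 : sagitta_length A B g1 f1)
  (hf2 : sagitta_length B C g2 f2)
  (hf3 : sagitta_length C A g3 f3)
  (hk1 : k = l1 / f1) (hk2 : k = l2 / f2) (hk3 : k = l3 / f3)
  (c1 c2 c3 : R)
  (hc1 : curve_length 0 1 g1 = c1%:E)
  (hc2 : curve_length 0 1 g2 = c2%:E)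
  (hc3 : curve_length 0 1 g3 = c3%:E) :
  c1 ^+ 2 = c2 ^+ 2 + c3 ^+ 2.
Proof.
subst l1 l2 l3.
have pyth : eucl_dist A B ^+ 2 = eucl_dist B C ^+ 2 + eucl_dist C A ^+ 2.
  rewrite !sqr_eucl_norm.
  have -> : dot (A - B) (A - B) =
    dot (B - C) (B - C) + dot (C - A) (C - A) - 2 * dot (A - C) (B - C).
    by rewrite /dot /=; ring.
  by rewrite hright mulr0 subr0.
have hAB : A <> B.
  move=> AB; apply: hBC; apply/eqP; rewrite -subr_eq0 -dot_eq0; apply/eqP.
  by rewrite -hright AB.
have l1_gt0 := eucl_dist_gt0 hAB.
move: hc1 hc2 hc3.
rewrite (curve_length_symmetric_conic_arc hAB harc1 hf1 hk1).
rewrite (curve_length_symmetric_conic_arc hBC harc2 hf2 hk2).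
rewrite (curve_length_symmetric_conic_arc hCA harc3 hf3 hk3).
rewrite -(propext haxis12) -(propext haxis13).
set L := curve_length _ _ _ => L1.
(* [L] is an extended real; an infinite value times the positive length of the hypotenuse would be
   infinite, unlike [c1]. *)
have Lfin : L \is a fin_num.
  have : ((eucl_dist A B)%:E * L)%E \is a fin_num by rewrite L1.
  by case: L {L1} => //; rewrite ?gt0_muley ?gt0_muleNy ?lte_fin.
move: L1; rewrite -(fineK Lfin) -!EFinM => -[<-] [<-] [<-].
by rewrite !exprMn pyth mulrDl.
Qed.
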